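(* Let $G$ be a finite simple graph of order $n$ having no connected component of order less than $3$ and no connected component isomorphic to the star $K_{1,2u+1}$ for any integer $u\geq 1$. Then $k(G)=n$ if $n\equiv 1\pmod 2$; $k(G)=n+1$ if $n\equiv 2\pmod 4$; and $k(G)\leq n+1$ if $n\equiv 0\pmod 4$.
   Context: The modular edge-gracefulness $k(G)$ of a graph $G$ of order $n$ is the smallest integer $k\geq n$ for which there exists an edge labeling $f:E(G)\rightarrow\mathbb{Z}_k$ such that the induced vertex labeling $f'(u)=\sum_{v\in N(u)} f(uv) \bmod k$ is one-to-one. *)

(* Defs.v *)
From HB Require Import structures.
From mathcomp Require Import all_boot.

Set Implicit Arguments.
Unset Strict Implicit.
Unset Printing Implicit Defensive.

Record sgraph := SGraph {
  vertex :> finType;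
  adj : rel vertex;
  adj_sym : symmetric adj;
  adj_irrefl : irreflexive adj
}.

Definition graph_iso (G H : sgraph) : Prop :=
  exists2 h : G -> H, bijective h & forall x y, adj (h x) (h y) = adj x y.

Section Induced.
Variables (G : sgraph) (A : {set G}).

Definition induced_adj : rel {x : G | x \in A} :=
  fun x y => adj (val x) (val y).

Lemma induced_adj_sym : symmetric induced_adj.
Proof. by move=> x y; apply: adj_sym. Qed.

Lemma induced_adj_irrefl : irreflexive induced_adj.
Proof. by move=> x; apply: adj_irrefl. Qed.

Definition induced : sgraph := SGraph induced_adj_sym induced_adj_irrefl.
End Induced.

Section CompleteBipartite.
Variables m n : nat.

Definition biclique_adj : rel ('I_m + 'I_n) :=
  fun x y => match x, y with
             | inl _, inr _ | inr _, inl _ => true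
             | _, _ => false
             end.

Lemma biclique_adj_sym : symmetric biclique_adj.
Proof. by move=> [x|x] [y|y]. Qed.

Lemma biclique_adj_irrefl : irreflexive biclique_adj.
Proof. by case. Qed.

Definition biclique : sgraph := SGraph biclique_adj_sym biclique_adj_irrefl.
End CompleteBipartite.

Definition component (G : sgraph) (x : G) : {set G} :=
  [set y | connect (@adj G) x y].

Definition components (G : sgraph) : {set {set G}} :=
  [set component x | x : G].

Section ModularEdgeGraceful.
Variable G : sgraph.

(* The edge uv is the unordered pair [set u; v]. An edge labeling is given as
   a function on all sets of vertices, but only its values on edges are ever
   used. Elements of Z_k are represented by their residues in 'I_k. *)
Definition vertex_label (k : nat) (f : {set G} -> 'I_k) (u : G) : nat :=
  (\sum_(v | adj u v) f [set u; v]) %% k.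

Definition modular_edge_graceful (k : nat) : Prop :=
  exists f : {set G} -> 'I_k, injective (vertex_label f).

(* [is_gracefulness k] says that k(G) is defined and equal to k. It is stated
   as a relation because for some graphs (such as K_2) no k is admissible. *)
Definition is_gracefulness (k : nat) : Prop :=
  [/\ #|G| <= k, modular_edge_graceful k
    & forall j, #|G| <= j -> modular_edge_graceful j -> k <= j].

Lemma is_gracefulness_uniq (k l : nat) :
  is_gracefulness k -> is_gracefulness l -> k = l.
Proof.
move=> [Gk gk mink] [Gl gl minl].
by apply/eqP; rewrite eqn_leq mink // minl.
Qed.
End ModularEdgeGraceful.

(* Main.v *)
Require Import Defs.
From HB Require Import structures.
From mathcomp Require Import all_boot all_algebra zify.

(* Let k >= n be odd. A walk of length b from u to v realizes, by alternating
   signs along it, the weight a on u and -(-1)^b a on v. Hence two vertices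
   joined by an even walk may receive the labels a, -a, and a vertex u joined by
   odd walks to v and z may receive a + b with a on v and b on z. Under the
   hypotheses every component splits into such pairs and triples: pair off
   the vertices within each colour class, use one triple if exactly one class is
   odd, and two triples centred in opposite classes if both are odd (this is
   where odd stars fail; in a non-bipartite component walks of both parities
   always exist). The triples are used two at a time, with labels
   (a + b, a, b) and their opposites; if their number is odd, one triple is
   replaced by a pair and a single vertex labelled 0. So it remains to find t
   disjoint sets {a, b, a + b, -a, -b, -(a + b)} in Z_k minus 0 whenever
   6t < k, which is Heffter's difference problem, solved by Skolem and hooked
   Skolem sequences.

   If n = 2 mod 4, the sum 0 + 1 + ... + (n - 1) is odd, whereas the vertex
   labels add up to twice the sum of the edge labels modulo the even number n,
   so k = n is impossible. *)

Set Implicit Arguments.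
Unset Strict Implicit.
Unset Printing Implicit Defensive.
Import GRing.Theory.

(** * Skolem sequences *)

(* The pairs {x d, x d + d}, 1 <= d <= t, are disjoint and avoid h, so they fill
   {1, ..., 2t} (h = 2t + 1) or, in the hooked case, {1, ..., 2t - 1, 2t + 1}. *)
Definition skolem (t : nat) (x : nat -> nat) : Prop :=
  (exists2 h, 2 * t <= h <= 2 * t + 1 &
     forall d, 0 < d <= t -> [/\ 0 < x d, x d + d <= 2 * t + 1, x d <> h & x d + d <> h]) /\
  (forall d e, 0 < d < e -> e <= t ->
     [/\ x d <> x e, x d <> x e + e, x e <> x d + d & x d + d <> x e + e]).

(* Skolem's and O'Keefe's explicit sequences, of orders 4s, 4s + 1, 4s + 2 and
   4s - 1 respectively. *)
Definition skolem0 s d :=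
  if ~~ odd d then 4 * s + (4 * s + 2 - d)./2 - 1
  else if d == 1 then s
  else if d == 2 * s + 1 then s - 1
  else if d == 2 * s - 1 then 2 * s
  else if d == 4 * s - 1 then 2 * s + 1
  else if 2 * s + 1 < d then (4 * s - 1 - d)./2
  else s + 1 + (2 * s - 1 - d)./2.

Definition skolem1 s d :=
  if ~~ odd d then 4 * s + 1 + (4 * s + 2 - d)./2
  else if d == 1 then s + 1
  else if d == 4 * s + 1 then 2 * s + 1
  else if d == 2 * s - 1 then 2 * s + 2
  else if 2 * s < d then (4 * s + 1 - d)./2
  else s + 2 + (2 * s - 1 - d)./2.

Definition skolem2 s d :=
  if d == 4 * s + 2 then 4 * s + 3
  else if ~~ odd d then (4 * s + 2 - d)./2
  else if d == 1 then 7 * s + 3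
  else if d == 4 * s + 1 then 2 * s + 1
  else if d == 2 * s + 1 then 4 * s + 2
  else if 2 * s + 1 < d then 4 * s + 3 + (4 * s + 1 - d)./2
  else 5 * s + 2 + (2 * s + 1 - d)./2.

Definition skolem3 s d :=
  if d == 4 * s - 1 then 4 * s
  else if d == 4 * s - 2 then 2 * s + 1
  else if ~~ odd d then 4 * s + (4 * s - 2 - d)./2
  else if d == 1 then s
  else if d == 2 * s + 1 then s - 1
  else if d == 2 * s - 1 then 2 * s
  else if 2 * s + 1 < d then (4 * s - 1 - d)./2
  else s + 1 + (2 * s - 1 - d)./2.

(** Once the branch conditions are fixed, every claim is linear arithmetic with parity and
    halving. *)
Ltac skolem_cases := repeat case: ifP => ?; split; lia.

Lemma skolem0P s : 1 < s -> skolem (4 * s) (skolem0 s).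
Proof.
move=> s_gt1; rewrite /skolem0; split.
  exists (2 * (4 * s) + 1); first by lia.
  by move=> d d_range; skolem_cases.
by move=> d e lt_de le_e; skolem_cases.
Qed.

Lemma skolem1P s : 1 < s -> skolem (4 * s + 1) (skolem1 s).
Proof.
move=> s_gt1; rewrite /skolem1; split.
  exists (2 * (4 * s + 1) + 1); first by lia.
  by move=> d d_range; skolem_cases.
by move=> d e lt_de le_e; skolem_cases.
Qed.

Lemma skolem2P s : 0 < s -> skolem (4 * s + 2) (skolem2 s).
Proof.
move=> s_gt1; rewrite /skolem2; split.
  (* Orders 2 and 3 modulo 4 admit only hooked sequences, so the gap lies at twice the order. *)
  exists (2 * (4 * s + 2)); first by lia.
  by move=> d d_range; skolem_cases.
by move=> d e lt_de le_e; skolem_cases.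
Qed.

Lemma skolem3P s : 0 < s -> skolem (4 * s - 1) (skolem3 s).
Proof.
move=> s_gt1; rewrite /skolem3; split.
  exists (2 * (4 * s - 1)); first by lia.
  by move=> d d_range; skolem_cases.
by move=> d e lt_de le_e; skolem_cases.
Qed.

(** The four families start at orders 8, 9, 6 and 3, which leaves 0, 1, 2, 4 and 5 to explicit
    tables. *)
Lemma skolem_exists t : exists x, skolem t x.
Proof.
(* The added leading 0 makes the table start at [d = 1]. *)
pose small (r : seq nat) d := nth 0 (0 :: r) d.
have [/eqP ->|t0] := boolP (t == 0).
  by exists id; split=> [|d e]; [exists 0 => // d|]; lia.
have [/eqP ->|t1] := boolP (t == 1).
  exists (small [:: 1]); split=> [|d e]; last by lia.
  by exists 3 => // -[|[|d]].
have [/eqP ->|t2] := boolP (t == 2).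
  exists (small [:: 1; 3]); split=> [|]; first by exists 4 => // -[|[|[|d]]].
  by move=> [|[|[|d]]] [|[|[|e]]]; rewrite /small //=; lia.
have [/eqP ->|t4] := boolP (t == 4).
  exists (small [:: 1; 5; 3; 4]); split=> [|].
    by exists 9 => // -[|[|[|[|[|d]]]]].
  by move=> [|[|[|[|[|d]]]]] [|[|[|[|[|e]]]]]; rewrite /small //=; lia.
have [/eqP ->|t5] := boolP (t == 5).
  exists (small [:: 9; 2; 5; 3; 1]); split=> [|].
    by exists 11 => // -[|[|[|[|[|[|d]]]]]].
  by move=> [|[|[|[|[|[|d]]]]]] [|[|[|[|[|[|e]]]]]]; rewrite /small //=; lia.
have [q] : exists s, [\/ 1 < s /\ t = 4 * s, 1 < s /\ t = 4 * s + 1,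
                         0 < s /\ t = 4 * s + 2 | 0 < s /\ t = 4 * s - 1].
  case: (ltnP (t %% 4) 3) => r3; last first.
    by exists (t %/ 4).+1; apply: Or44; lia.
  exists (t %/ 4).
  case: (t %% 4) (divn_eq t 4) r3 => [|[|[|//]]] E _.
  - by apply: Or41; lia.
  - by apply: Or42; lia.
  - by apply: Or43; lia.
by case=> -[s_gt ->]; eexists; [apply: skolem0P|apply: skolem1P|apply: skolem2P|apply: skolem3P].
Qed.

(** * Realizable weights and walks *)

Section Realizable.
Variables (G : sgraph) (R : zmodType).
Local Open Scope ring_scope.
Implicit Types (u v y : G) (w : G -> R).

(** Values lie in an abelian group so that signs can alternate along walks; ['Z_k] is substituted at
    the end. *)
Definition realizable w : Prop :=
  exists f : {set G} -> R, forall u, w u = \sum_(v | adj u v) f [set u; v].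

Lemma eq_realizable w w' : w =1 w' -> realizable w -> realizable w'.
Proof. by move=> eww' [f fw]; exists f => u; rewrite -eww'. Qed.

Lemma realizable0 : realizable (fun=> 0).
Proof. by exists (fun=> 0) => u; rewrite big1. Qed.

Lemma realizableD w w' :
  realizable w -> realizable w' -> realizable (fun y => w y + w' y).
Proof.
move=> [f fw] [f' fw']; exists (fun e => f e + f' e) => u.
by rewrite fw fw' -big_split.
Qed.

(** The edge alone carries [a]; a boolean multiple serves as an indicator. *)
Lemma realizable_edge u v (a : R) : adj u v ->
  realizable (fun y => a *+ (y == u) + a *+ (y == v)).
Proof.
move=> uv; have neq_uv: u != v by apply: contraTneq uv => ->; rewrite adj_irrefl.
exists (fun e => a *+ (e == [set u; v])) => y.
have pairE z : adj y z -> ([set y; z] == [set u; v]) =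
    (y == u) && (z == v) || (y == v) && (z == u).
  move=> yz; have neq_yz: y != z by apply: contraTneq yz => ->; rewrite adj_irrefl.
  apply/eqP/idP => [e|].
    have : y \in [set u; v] by rewrite -e set21.
    have : z \in [set u; v] by rewrite -e set22.
    rewrite !inE; case/orP=> /eqP Ez; case/orP=> /eqP Ey; move: neq_yz;
      by rewrite Ey Ez !eqxx ?orbT.
  by case/orP=> /andP[/eqP-> /eqP->] //; rewrite setUC.
under eq_bigr => z yz do rewrite pairE //.
have [->|yu] := eqVneq y u.
  rewrite (negPf neq_uv) /= (bigD1 v) //= eqxx big1 ?addr0 //.
  by move=> z /andP[_ /negPf->].
have [->|yv] := eqVneq y v; last by rewrite /= big1 ?addr0.
rewrite /= (bigD1 u) ?(adj_sym v) //= eqxx big1 ?addr0 ?add0r //.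
by move=> z /andP[_ /negPf->].
Qed.

End Realizable.

(** * Walks and the parity of their length *)

Section WalkParity.
Variable G : sgraph.
Implicit Types (u v x y : G) (b c : bool).

(* Adjacency in the bipartite double cover: the second component tracks the
   parity of the length of a walk. *)
Definition cover_adj : rel (G * bool) :=
  fun p q => adj p.1 q.1 && (p.2 != q.2).

Definition walk u v b := connect cover_adj (u, false) (v, b).

Lemma cover_adj_sym : symmetric cover_adj.
Proof. by move=> p q; rewrite /cover_adj adj_sym eq_sym. Qed.

(** Exchanging the two sheets is an automorphism of the double cover. *)
Lemma cover_shift u v a b c :
  connect cover_adj (u, a) (v, b) -> connect cover_adj (u, a (+) c) (v, b (+) c).
Proof.
pose sh (p : G * bool) := (p.1, p.2 (+) c).
case/connectP=> p pth E; apply/connectP; exists (map sh p).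
  rewrite -[(u, _)]/(sh (u, a)); apply: (homo_path _ pth) => -[y1 b1] [y2 b2].
  rewrite /cover_adj /= => /andP[-> /=]; apply: contra => /eqP e.
  by rewrite -(addbK c b1) e addbK.
by rewrite -[(u, _)]/(sh (u, a)) last_map -E.
Qed.

Lemma walk0 u : walk u u false.
Proof. exact: connect0. Qed.

Lemma walk1 u v : adj u v -> walk u v true.
Proof. by move=> uv; apply: connect1; rewrite /cover_adj /= uv. Qed.

Lemma walk_trans v u y b c : walk u v b -> walk v y c -> walk u y (b (+) c).
Proof.
move=> uv vy; apply: connect_trans uv _.
by have := cover_shift b vy; rewrite addFb addbC.
Qed.

Lemma walk_sym u v b : walk u v b -> walk v u b.
Proof.
rewrite /walk (sym_connect_sym cover_adj_sym) => uv.
by have := cover_shift b uv; rewrite addbb addFb.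
Qed.

Lemma connect_walk u v : connect (@adj G) u v -> walk u v false || walk u v true.
Proof.
case/connectP=> p; elim/last_ind: p v => [v _ -> | p z IHp v]; first by rewrite walk0.
rewrite rcons_path last_rcons => /andP[pth lz] ->.
have /orP[uw|uw] := IHp _ pth erefl.
  by rewrite (walk_trans uw (walk1 lz)) orbT.
by rewrite (walk_trans uw (walk1 lz)).
Qed.

(** The ends may coincide: a closed odd walk then puts 2a on its end, a closed even one 0. *)
Lemma realizable_walk (R : zmodType) u v b (a : R) : walk u v b ->
  realizable (fun y => a *+ (y == u) + (if b then a else - a) *+ (y == v))%R.
Proof.
case/connectP=> p; elim/last_ind: p v b => [v b _ [-> ->]|p [z c] IHp v b].
  by apply: eq_realizable (realizable0 _ _) => y; rewrite mulNrn addrN.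
rewrite rcons_path last_rcons => /andP[pth lz] [-> ->].
case: (last _ p) (IHp (last (u, false) p).1 (last (u, false) p).2 pth) lz => y d /=.
move/(_ erefl) => rw /andP[/= yz /negPf dc].
(* The new edge carries the opposite of the weight accumulated at [y], which therefore cancels
   there. *)
have := realizableD rw (realizable_edge (if d then - a else a)%R yz).
apply: eq_realizable => t; rewrite -addrA; congr (_ + _)%R.
by case: d c dc {rw} => -[] //= _; rewrite addrA mulNrn ?addrN ?addNr add0r.
Qed.

End WalkParity.

(** * Pairs and triples of vertices *)

Section Decomposition.
Variable G : sgraph.
Implicit Types (u v x y z : G) (A B D : {set G}).
Implicit Types (P : seq (G * G)) (T : seq (G * G * G)).

Definition pair_elems P := flatten [seq [:: p.1; p.2] | p <- P].
Definition triple_elems T := flatten [seq [:: p.1.1; p.1.2; p.2] | p <- T].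

Definition even_pair (p : G * G) := walk p.1 p.2 false.
(** The first entry is the centre; through it the other two are joined by an even walk. *)
Definition odd_triple (p : G * G * G) :=
  walk p.1.1 p.1.2 true && walk p.1.1 p.2 true.

(** The permutation expresses covering, disjointness and distinctness at once. The walks themselves
    may leave [D]. *)
Definition decomposable D : Prop :=
  exists P T, [/\ all even_pair P, all odd_triple T
    & perm_eq (enum D) (pair_elems P ++ triple_elems T)].

Lemma decomposable0 : decomposable set0.
Proof. by exists [::], [::]; rewrite enum_set0. Qed.

Lemma decomposableU A B :
  [disjoint A & B] -> decomposable A -> decomposable B -> decomposable (A :|: B).
Proof.
move=> dAB [P [T [Pok Tok eA]]] [P' [T' [P'ok T'ok eB]]].
exists (P ++ P'), (T ++ T'); split; rewrite ?all_cat ?Pok ?Tok //.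
rewrite /pair_elems /triple_elems !map_cat !flatten_cat.
apply: (@perm_trans _ (enum A ++ enum B)); last first.
  apply: perm_trans (perm_cat eA eB) _.
  by rewrite -!catA perm_cat2l perm_catCA.
apply: uniq_perm; rewrite ?enum_uniq ?cat_uniq ?enum_uniq ?andbT //=.
  apply/hasPn => x; rewrite !mem_enum => xB; apply/negP => xA.
  by rewrite (disjointFr dAB xA) in xB.
by move=> x; rewrite mem_cat !mem_enum inE.
Qed.

Lemma decomposable_pair u v : u != v -> walk u v false -> decomposable [set u; v].
Proof.
move=> uv w; exists [:: (u, v)], [::]; rewrite /= /even_pair w; split=> //.
apply: uniq_perm; rewrite ?enum_uniq //= ?inE ?uv //.
by move=> y; rewrite mem_enum !inE.
Qed.

Lemma decomposable_triple u v z : u != v -> u != z -> v != z ->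
  walk u v true -> walk u z true -> decomposable [set u; v; z].
Proof.
move=> uv uz vz wv wz.
exists [::], [:: (u, v, z)]; rewrite /= /odd_triple wv wz; split=> //.
apply: uniq_perm; rewrite ?enum_uniq //= ?inE ?negb_or ?uv ?uz ?vz //.
by move=> y; rewrite mem_enum !inE -orbA.
Qed.

Definition same_class A := {in A &, forall u v, walk u v false}.

Lemma same_classS A B : A \subset B -> same_class B -> same_class A.
Proof. by move=> /subsetP AB cB u v /AB uB /AB vB; apply: cB. Qed.

Lemma decomposable_even_class A : same_class A -> ~~ odd #|A| -> decomposable A.
Proof.
have [m] := ubnP #|A|; elim: m A => // m IHm A ltAm cA evA.
have [->|[u uA]] := set_0Vmem A; first exact: decomposable0.
have cAu := cardsD1 u A; rewrite uA in cAu.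
have [v vA] : exists v, v \in A :\ u.
  by apply/set0Pn; rewrite -card_gt0; lia.
have cAv := cardsD1 v (A :\ u); rewrite vA in cAv.
have -> : A = [set u; v] :|: (A :\ u) :\ v.
  apply/setP=> y; rewrite !inE; move: vA; rewrite !inE => /andP[_ vA].
  by case: eqP => [->|]; case: eqP => [->|]; rewrite ?uA ?vA.
apply: decomposableU.
- by rewrite -setI_eq0; apply/eqP/setP=> y; rewrite !inE; case: eqP; case: eqP.
- move: vA; rewrite !inE eq_sym => /andP[uv vA].
  by apply: decomposable_pair => //; apply: cA.
- apply: IHm; [by lia| |by lia].
  by apply: same_classS cA; rewrite !subDset; apply/subsetP=> y yA; rewrite !inE yA !orbT.
Qed.

Definition cross_class A B := {in A & B, forall u v, walk u v true}.

Lemma decomposable_even_classes A B : [disjoint A & B] ->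
  same_class A -> same_class B ->
  ~~ odd #|A| -> ~~ odd #|B| -> decomposable (A :|: B).
Proof.
by move=> dAB cA cB evA evB; apply: decomposableU => //; apply: decomposable_even_class.
Qed.

(** The centre is taken from [A] and both ends from [B], so only the parity of [A] changes. *)
Lemma extract_triple A B : [disjoint A & B] -> cross_class A B ->
  0 < #|A| -> 1 < #|B| ->
  exists D A' B', [/\ decomposable D, [/\ A' \subset A, B' \subset B,
    #|A| = #|A'|.+1 & #|B| = #|B'|.+2], A :|: B = D :|: (A' :|: B')
    & [disjoint D & A' :|: B']].
Proof.
move=> dAB cAB /card_gt0P[u uA] /card_gt1P[v [z [vB zB vz]]].
have neqAB y t : y \in A -> t \in B -> y != t.
  by move=> yA tB; apply: contraTneq yA => ->; rewrite (disjointFl dAB tB).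
exists [set u; v; z], (A :\ u), (B :\ v :\ z); split.
- by apply: decomposable_triple => //; [apply: neqAB..|apply: cAB|apply: cAB].
- split; rewrite ?subsetDl //.
  + by rewrite subDset; apply/subsetP=> y; rewrite !inE => /andP[_ ->]; rewrite orbT.
  + by rewrite (cardsD1 u A) uA.
  + by rewrite (cardsD1 v B) vB (cardsD1 z (B :\ v)) !inE eq_sym vz zB.
- apply/setP=> y; rewrite !inE.
  case: (eqVneq y u) => [->|]; rewrite ?uA //=.
  case: (eqVneq y v) => [->|]; rewrite ?vB ?orbT //=.
  by case: (eqVneq y z) => [->|]; rewrite ?zB ?orbT //=.
- rewrite -setI_eq0; apply/eqP/setP=> y; rewrite !inE.
  have uNB := disjointFr dAB uA.
  have vNA := disjointFl dAB vB; have zNA := disjointFl dAB zB.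
  case: (eqVneq y u) => [->|]; rewrite ?uNB ?andbF //=.
  case: (eqVneq y v) => [->|]; rewrite ?vNA ?andbF //=.
  by case: (eqVneq y z) => [->|]; rewrite ?zNA ?andbF //=.
Qed.

(* When both classes are odd, two triples centred in opposite classes are used:
   removing the first one leaves an even class and an odd class. *)
Lemma decomposable_classes A B : [disjoint A & B] ->
  same_class A -> same_class B -> cross_class A B ->
  (odd #|A| -> 1 < #|B|) -> (odd #|B| -> 1 < #|A|) -> decomposable (A :|: B).
Proof.
have odd_even A' B' : [disjoint A' & B'] ->
    same_class A' -> same_class B' -> cross_class A' B' ->
    odd #|A'| -> ~~ odd #|B'| -> 1 < #|B'| -> decomposable (A' :|: B').
  move=> d cA cB cAB oA eB B2.
  have [||D [A1 [B1 [dD [sA sB eqA eqB] -> dis]]]] := extract_triple d cAB; [lia..|].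
  apply: decomposableU => //; apply: decomposable_even_classes.
  - exact: disjointWl sA (disjointWr sB d).
  - exact: same_classS cA.
  - exact: same_classS cB.
  - by lia.
  - by lia.
move=> d cA cB cAB A2 B2; case oA: (odd #|A|); case oB: (odd #|B|).
- have [||D [A1 [B1 [dD [sA sB eqA eqB] -> dis]]]] := extract_triple d cAB; [lia..|].
  (* Both classes have at least 3 vertices, so [A1] still has two ends to offer to a triple centred
     in [B1]. *)
  apply: decomposableU => //; rewrite setUC.
  apply: odd_even; [|exact: same_classS cB|exact: same_classS cA| |lia..].
    by rewrite disjoint_sym; exact: disjointWl sA (disjointWr sB d).
  move=> u v uB vA; apply: walk_sym; apply: cAB.
    by apply: (subsetP sA).
  by apply: (subsetP sB).
- by apply: odd_even => //; lia.
- rewrite setUC; apply: odd_even; rewrite ?oA ?B2 //; first by rewrite disjoint_sym.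
  by move=> u v uB vA; apply: walk_sym; apply: cAB.
- by apply: decomposable_even_classes; rewrite ?oA ?oB.
Qed.

(** * Stars and connected components *)

Definition is_odd_star (C : {set G}) :=
  exists2 u, 1 <= u & graph_iso (induced C) (biclique 1 (2 * u + 1)).

(** The isomorphism sends [z] to the one-point side and numbers the other vertices; it is injective
    between sets of equal size. *)
Lemma star_iso (C : {set G}) z q : z \in C ->
  {in C &, forall u v, adj u v = (u == z) (+) (v == z)} ->
  #|C| = q.+2 -> graph_iso (induced C) (biclique 1 q.+1).
Proof.
move=> zC adjE cardC; have cC := cardsD1 z C; rewrite zC cardC in cC.
pose h (x : induced C) : biclique 1 q.+1 :=
  if val x == z then inl ord0 else inr (inord (index (val x) (enum (C :\ z)))).
exists h.
  apply: inj_card_bij; last by rewrite card_sum !card_ord card_sig cardC.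
  move=> x y; rewrite /h; case: eqP => xz; case: eqP => yz //.
    by move=> _; apply: val_inj; rewrite xz yz.
  case.
  have memC (t : induced C) : val t <> z -> val t \in enum (C :\ z).
    by move=> /eqP tz; rewrite mem_enum !inE tz (valP t).
  have ltC (t : induced C) : val t <> z -> index (val t) (enum (C :\ z)) < q.+1.
    by move/memC; rewrite -index_mem -cardE; case: cC => ->.
  move/(congr1 val); rewrite /= !inordK ?ltC // => e.
  by apply: val_inj; exact: (index_inj z (memC _ xz) (memC _ yz) e).
move=> x y; rewrite -[RHS]/(adj (val x) (val y)) adjE ?(valP x) ?(valP y) //.
by rewrite /h; case: eqP; case: eqP.
Qed.

Lemma odd_star_center (C : {set G}) z : z \in C ->
  {in C &, forall u v, adj u v = (u == z) (+) (v == z)} ->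
  ~~ odd #|C| -> 2 < #|C| -> is_odd_star C.
Proof.
move=> zC adjE evC C2; exists #|C|./2.-1; first by lia.
have -> : 2 * #|C|./2.-1 + 1 = (#|C|.-2).+1 by lia.
by apply: star_iso adjE _ => //; lia.
Qed.

Lemma component_neighbor x y : 1 < #|component x| -> y \in component x ->
  exists2 z, z \in component x & adj y z.
Proof.
move=> C1 yC; have cC := cardsD1 y (component x); rewrite yC in cC.
have [t] : exists t, t \in component x :\ y.
  by apply/set0Pn; rewrite -card_gt0; lia.
move: yC; rewrite !inE => xy /andP[ty xt].
have : connect (@adj G) y t.
  by apply: connect_trans xt; rewrite (sym_connect_sym (@adj_sym G)).
case/connectP=> -[/= _ e|z p /= /andP[yz _] _]; first by rewrite e eqxx in ty.
by exists z => //; rewrite inE; apply: connect_trans xy (connect1 yz).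
Qed.

Lemma decomposable_component x :
  2 < #|component x| -> ~ is_odd_star (component x) -> decomposable (component x).
Proof.
set C := component x => C2 nstar.
have xC : x \in C by rewrite inE connect0.
have walkC u v : u \in C -> v \in C -> walk u v false || walk u v true.
  rewrite !inE => xu xv; apply: connect_walk; apply: connect_trans xv.
  by rewrite (sym_connect_sym (@adj_sym G)).
(* Non-bipartite case: a detour through a closed odd walk at [x] gives walks of both parities
   between any two vertices. *)
have [xx|Nxx] := boolP (walk x x true).
  have allC b u v : u \in C -> v \in C -> walk u v b.
    move=> uC vC; have {uC}wu b' : walk u x b'.
      have /orP[w|w] := walkC u x uC xC.
        by case: b'; [exact: (walk_trans w xx)|].
      by case: b'; [|exact: (walk_trans w xx)].
    have /orP[w|w] := walkC x v xC vC; first by have := walk_trans (wu b) w; rewrite addbF.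
    by have := walk_trans (wu (~~ b)) w; rewrite addbT negbK.
  have [oC|eC] := boolP (odd #|C|); last first.
    by apply: decomposable_even_class => // u v uC vC; apply: allC.
  have cC := cardsD1 x C; rewrite xC in cC.
  (* Any split into two classes is now allowed; one vertex against the even remainder is enough. *)
  have -> : C = [set x] :|: C :\ x by rewrite setD1K.
  apply: decomposable_classes; rewrite ?cards1; [| | | |lia..].
  - by rewrite disjoints1 !inE eqxx.
  - by move=> u v /set1P-> /set1P->; apply: walk0.
  - by move=> u v /setD1P[_ uC] /setD1P[_ vC]; apply: allC.
  - by move=> u v /set1P-> /setD1P[_ vC]; apply: allC.
(* Bipartite case: the parity of walks from [x] defines the colour classes. *)
pose A := [set v in C | walk x v true]; pose B := [set v in C | walk x v false].
have wA u : u \in A -> walk x u true by rewrite inE => /andP[].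
have wB u : u \in B -> walk x u false by rewrite inE => /andP[].
have CE : C = A :|: B.
  by apply/setP=> v; rewrite !inE -andb_orr orbC; case: (boolP (connect _ _ _)) => // xv;
     rewrite walkC ?inE.
have dAB : [disjoint A & B].
  rewrite -setI_eq0; apply/eqP/setP=> v; rewrite in_setI in_set0; apply/negP=> /andP[/wA vA /wB vB].
  by move/negP: Nxx; apply; exact: (walk_trans vA (walk_sym vB)).
have cA : same_class A.
  by move=> u v /wA uA /wA vA; exact: (walk_trans (walk_sym uA) vA).
have cB : same_class B.
  by move=> u v /wB uB /wB vB; exact: (walk_trans (walk_sym uB) vB).
have cAB : cross_class A B.
  by move=> u v /wA uA /wB vB; exact: (walk_trans (walk_sym uA) vB).
have cardC : #|C| = #|A| + #|B|.
  by rewrite CE cardsU (eqP (_ : A :&: B == set0)) ?setI_eq0 // cards0 subn0.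
have adjAB u v : u \in C -> adj u v -> (u \in A) (+) (v \in A).
  move=> uC uv; have vC : v \in C.
    by move: uC; rewrite !inE => xu; exact: connect_trans xu (connect1 uv).
  have noloop y : y \in C -> walk y y true -> False.
    move=> yC yy; move/negP: Nxx; apply.
    have /orP[w|w] := walkC x y xC yC; first exact: (walk_trans w (walk_trans yy (walk_sym w))).
    exact: (walk_trans w (walk_trans yy (walk_sym w))).
  move: (uC) (vC); rewrite {1 2}CE ![_ \in A :|: B]in_setU.
  case uA: (u \in A); case vA: (v \in A) => //= uB vB.
    by case: (noloop u uC); exact: (walk_trans (walk1 uv) (cA _ _ vA uA)).
  by case: (noloop u uC); exact: (walk_trans (walk1 uv) (cB _ _ vB uB)).
(* If a colour class is reduced to [z], every edge in [C] has [z] as an end, and every other vertex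
   has a neighbour, necessarily [z]. So [C] is a star, and its even order makes it an odd star. *)
have star z : z \in C -> ~~ odd #|C| ->
    {in C, forall u, (u \in A) = (u == z)} \/ {in C, forall u, (u \in A) = (u != z)} -> False.
  move=> zC eC Az; apply: nstar; apply: (odd_star_center zC) => // u v uC vC.
  have adjz y t : y \in C -> t \in C -> adj y t -> (y == z) (+) (t == z).
    move=> yC tC /(adjAB _ _ yC).
    by case: Az => AE; rewrite !AE //; case: (y == z); case: (t == z).
  apply/idP/idP => [|uvz]; first exact: adjz.
  wlog uz : u v uC vC uvz / u == z.
    move=> IH; case uz: (u == z); first exact: IH.
    by rewrite adj_sym; apply: IH => //; [rewrite addbC|move: uvz; rewrite uz].
  have [t tC vt] := component_neighbor (ltnW C2) vC.
  move: (adjz _ _ vC tC vt) uvz; rewrite uz /= => + /negPf vz.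
  by rewrite vz /= => /eqP tz; rewrite (eqP uz) adj_sym -tz.
have AC : A \subset C by rewrite CE subsetUl.
have BC : B \subset C by rewrite CE subsetUr.
have [y yC xy] := component_neighbor (ltnW C2) xC.
have A0 : 0 < #|A| by apply/card_gt0P; exists y; rewrite inE yC walk1.
have B0 : 0 < #|B| by apply/card_gt0P; exists x; rewrite inE xC walk0.
have NAB u : u \in C -> (u \in A) = (u \notin B).
  rewrite {1}CE in_setU; case uA: (u \in A) => /= uB; last by rewrite uB.
  by rewrite (disjointFr dAB uA).
have A1 : odd #|A| -> odd #|B| -> #|A| <> 1.
  move=> oA oB /eqP/cards1P[z Az]; apply: (star z); [|lia|].
    by apply: (subsetP AC); rewrite Az set11.
  by left=> u _; rewrite Az inE.
have B1 : odd #|A| -> odd #|B| -> #|B| <> 1.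
  move=> oA oB /eqP/cards1P[z Bz]; apply: (star z); [|lia|].
    by apply: (subsetP BC); rewrite Bz set11.
  by right=> u uC; rewrite NAB // Bz inE.
by rewrite CE; apply: decomposable_classes => //; lia.
Qed.

(** Allowing any union of components lets the induction remove one component at a time. *)
Lemma decomposable_closed D :
  (forall x, x \in D -> component x \subset D) ->
  (forall x, 2 < #|component x|) -> (forall x, ~ is_odd_star (component x)) ->
  decomposable D.
Proof.
move=> + C2 nstar; have [m] := ubnP #|D|; elim: m D => // m IHm D ltDm clD.
have [->|[x xD]] := set_0Vmem D; first exact: decomposable0.
have sCD := clD x xD.
have -> : D = component x :|: (D :\: component x) by rewrite -{1}(setID D (component x)) (setIidPr sCD).
apply: decomposableU; [|exact: decomposable_component|].
  by have /subsetDP[_] := subxx (D :\: component x); rewrite disjoint_sym.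
apply: IHm.
  by rewrite cardsDS //; have := C2 x; have := subset_leq_card sCD; lia.
move=> y /setDP[yD yNC]; rewrite subsetD clD //=.
rewrite -setI_eq0; apply/eqP/setP=> t; rewrite !inE; apply/negP=> /andP[yt xt].
move/negP: yNC; apply; rewrite inE; apply: connect_trans xt _.
by rewrite (sym_connect_sym (@adj_sym G)).
Qed.

End Decomposition.

(** * Labels *)

Section Weights.
Variables (G : sgraph) (R : zmodType).
Local Open Scope ring_scope.
Implicit Types (l : seq (G * R)) (P : seq (G * G)) (T : seq (G * G * G)).
Implicit Types (Q : seq R) (S : seq (R * R)).

(** With distinct vertices in [l] this is a lookup table extended by 0; the form of a sum makes
    concatenation additive. *)
Definition weight l (y : G) : R := \sum_(p <- l) p.2 *+ (y == p.1).

Lemma map_weight l : uniq (unzip1 l) -> map (weight l) (unzip1 l) = unzip2 l.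
Proof.
elim: l => //= -[v a] l IHl /= /andP[vl /IHl <-]; congr (_ :: _).
  rewrite /weight big_cons /= eqxx big_seq big1 ?addr0 // => p pl.
  by case: eqP => // vp; case/negP: vl; rewrite vp; apply: map_f.
apply/eq_in_map => y yl; rewrite /weight big_cons /=.
by case: eqP => [yv|_]; rewrite ?add0r // -yv yl in vl *.
Qed.

Lemma realizable_weight_cat l l' :
  realizable (weight l) -> realizable (weight l') -> realizable (weight (l ++ l')).
Proof.
move=> rl rl'; apply: eq_realizable (realizableD rl rl') => y.
by rewrite /weight big_cat.
Qed.

(** [zip] truncates to the shorter list; equal lengths are imposed where vertices and values are
    read off. *)
Definition label_pairs P Q :=
  flatten [seq [:: (p.1.1, p.2); (p.1.2, - p.2)] | p <- zip P Q].
Definition label_triples T S :=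
  flatten [seq [:: (p.1.1.1, p.2.1 + p.2.2); (p.1.1.2, p.2.1); (p.1.2, p.2.2)]
          | p <- zip T S].
Definition triple_values S := flatten [seq [:: p.1 + p.2; p.1; p.2] | p <- S].
Definition opp_pairs S := [seq (- p.1, - p.2) | p <- S].

Lemma realizable_label_pairs P Q :
  all (@even_pair G) P -> realizable (weight (label_pairs P Q)).
Proof.
elim: P Q => [|[u v] P IHP] [|a Q] => [_|_|_|/= /andP[uv /IHP rP]];
  try by apply: eq_realizable (realizable0 _ _) => y; rewrite /weight big_nil.
have := realizable_weight_cat (l := [:: (u, a); (v, - a)]) _ (rP Q).
apply; apply: eq_realizable (realizable_walk a uv) => y.
by rewrite /weight !big_cons big_nil addr0.
Qed.

Lemma realizable_label_triples T S :
  all (@odd_triple G) T -> realizable (weight (label_triples T S)).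
Proof.
elim: T S => [|[[u v] z] T IHT] [|[a b] S] => [_|_|_|/= /andP[/andP[uv uz] /IHT rT]];
  try by apply: eq_realizable (realizable0 _ _) => y; rewrite /weight big_nil.
have := realizable_weight_cat (l := [:: (u, a + b); (v, a); (z, b)]) _ (rT S).
apply; apply: eq_realizable (realizableD (realizable_walk a uv) (realizable_walk b uz)).
move=> y; rewrite /weight !big_cons big_nil addr0 /= mulrnDl !addrA.
by congr (_ + _); rewrite addrAC.
Qed.

Lemma unzip1_label_pairs P Q :
  size P = size Q -> unzip1 (label_pairs P Q) = pair_elems P.
Proof.
by elim: P Q => [|p P IHP] [|a Q] //= [/IHP]; rewrite /label_pairs /pair_elems /= => ->.
Qed.

Lemma unzip1_label_triples T S :
  size T = size S -> unzip1 (label_triples T S) = triple_elems T.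
Proof.
by elim: T S => [|p T IHT] [|a S] //= [/IHT]; rewrite /label_triples /triple_elems /= => ->.
Qed.

Lemma unzip2_label_pairs P Q : size P = size Q ->
  perm_eq (unzip2 (label_pairs P Q)) (Q ++ map -%R Q).
Proof.
elim: P Q => [|p P IHP] [|a Q] //= [/IHP /permP eQ].
apply/permP=> c; move: (eQ c); rewrite /label_pairs /= !count_cat /=; lia.
Qed.

Lemma unzip2_label_triples T S :
  size T = size S -> unzip2 (label_triples T S) = triple_values S.
Proof.
by elim: T S => [|p T IHT] [|a S] //= [/IHT]; rewrite /label_triples /triple_values /= => ->.
Qed.

Lemma triple_values_opp S : triple_values (opp_pairs S) = map -%R (triple_values S).
Proof. by elim: S => //= -[a b] S; rewrite /triple_values /= => ->; rewrite opprD. Qed.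

Definition sym_free (Q : seq R) := uniq (0 :: Q ++ map -%R Q).

Lemma injective_labeling (Z : seq G) P T1 T2 Q S :
  (size Z <= 1)%N -> all (@even_pair G) P -> all (@odd_triple G) (T1 ++ T2) ->
  perm_eq (enum G) (Z ++ pair_elems P ++ triple_elems (T1 ++ T2)) ->
  size P = size Q -> size T1 = size S -> size T2 = size S ->
  sym_free (triple_values S ++ Q) ->
  exists f : {set G} -> R, injective (fun u => \sum_(v | adj u v) f [set u; v]).
Proof.
move=> Z1 Pok Tok eG sQ s1 s2 frS.
pose l := [seq (z, 0) | z <- Z] ++ label_pairs P Q ++
  label_triples T1 S ++ label_triples T2 (opp_pairs S).
move: Tok; rewrite all_cat => /andP[T1ok T2ok].
have s2' : size T2 = size (opp_pairs S) by rewrite size_map.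
have l1 : unzip1 l = Z ++ pair_elems P ++ triple_elems (T1 ++ T2).
  rewrite /unzip1 /l !map_cat -map_comp map_id_in //; congr (_ ++ _).
  rewrite -!/(unzip1 _) unzip1_label_pairs // !unzip1_label_triples //.
  by rewrite /triple_elems map_cat flatten_cat.
have l2 : uniq (unzip2 l).
  rewrite /unzip2 /l !map_cat -map_comp -!/(unzip2 _) !unzip2_label_triples //.
  rewrite triple_values_opp; set X := triple_values S.
  have perm_l : perm_eq (unzip2 (label_pairs P Q) ++ X ++ map -%R X)
                        ((X ++ Q) ++ map -%R (X ++ Q)).
    rewrite map_cat; apply: perm_trans (perm_cat (unzip2_label_pairs sQ) (perm_refl _)) _.
    apply/permP=> c; rewrite !count_cat; lia.
  move: frS; rewrite /sym_free cons_uniq -(perm_mem perm_l) -(perm_uniq perm_l) => /andP[N0 U].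
  case: Z Z1 {eG l l1} => [|z [|//]] //= _.
  by rewrite N0.
have [f fw] : realizable (weight l).
  apply: realizable_weight_cat.
    apply: eq_realizable (realizable0 _ _) => y.
    by rewrite /weight big_map big1 // => z _; rewrite mul0rn.
  apply: realizable_weight_cat; first exact: realizable_label_pairs.
  by apply: realizable_weight_cat; apply: realizable_label_triples.
exists f => u v; rewrite -!fw; apply: (injectiveP (weight l) _).
have el : perm_eq (enum G) (unzip1 l) by rewrite l1.
(* Listed along [enum G], the labels are a permutation of [unzip2 l], already known to be
   duplicate-free. *)
rewrite /injectiveb /dinjectiveb (perm_uniq (perm_map _ el)) map_weight //.
by rewrite -(perm_uniq el) enum_uniq.
Qed.

End Weights.

(** * Disjoint symmetric label sets in the integers modulo an odd k *)

Section SymFreeZp.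
Variable k' : nat.
(** ['Z_0] and ['Z_1] both have two elements, so the shape [k'.+2] guarantees true residues modulo
    k. *)
Let k := k'.+2.
Hypothesis k_odd : odd k.
Local Open Scope ring_scope.
Implicit Types (Q : seq 'Z_k).

Lemma natr_eq0_Zp (m : nat) : ((m%:R : 'Z_k) == 0) = (k %| m)%N.
Proof. by rewrite -val_eqE /= val_Zp_nat. Qed.

Lemma natr_inj_Zp (m n : nat) : (m < k)%N -> (n < k)%N -> m%:R = n%:R :> 'Z_k -> m = n.
Proof. by move=> mk nk /(congr1 val); rewrite /= !val_Zp_nat // !modn_small. Qed.

(** Twice [a] vanishes, and 2 is coprime to the odd k. *)
Lemma opp_fixed_Zp (a : 'Z_k) : a = - a -> a = 0.
Proof.
move=> e; have /eqP : a + a = 0 by rewrite {1}e addNr.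
rewrite -{1 2}[a]natr_Zp -natrD natr_eq0_Zp addnn -mul2n Gauss_dvdr; last by rewrite coprimen2.
by rewrite -natr_eq0_Zp natr_Zp => /eqP.
Qed.

(** Greedy choice: 0, the values chosen so far and their opposites make fewer than k entries, so
    some [a] is missed, and it differs from its opposite because k is odd. *)
Lemma sym_free_extend Q p : sym_free Q -> ((size Q + p).*2 < k)%N ->
  exists2 Q', size Q' = p & sym_free (Q ++ Q').
Proof.
elim: p => [|p IHp] frQ ltk; first by exists [::]; rewrite ?cats0.
have [|Q' sQ' frQ'] := IHp frQ; first by lia.
set X := Q ++ Q' in frQ'.
have [a aN] : exists a : 'Z_k, a \notin 0 :: X ++ map -%R X.
  apply/existsP; rewrite -negb_forall; apply/negP => /forallP allX.
  pose Y := 0 :: X ++ map -%R X.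
  have : (#|'Z_k| <= size Y)%N.
    rewrite cardE; apply: uniq_leq_size; first exact: enum_uniq.
    by move=> y _; apply: allX.
  have -> : #|'Z_k| = k by rewrite card_ord.
  by rewrite /= size_cat size_map /X size_cat sQ'; lia.
exists (rcons Q' a); first by rewrite size_rcons sQ'.
rewrite -rcons_cat -/X.
have pX : perm_eq (0 :: rcons X a ++ map -%R (rcons X a))
                  [:: a, - a, 0 & X ++ map -%R X].
  by apply/permP=> c; rewrite map_rcons -!cats1 /= !count_cat /=; lia.
move: (aN); rewrite inE mem_cat !negb_or => /and3P[a0 aX aNX].
have aNa : a != - a by apply: contra_neq a0; apply: opp_fixed_Zp.
have NaN : - a \notin 0 :: X ++ map -%R X.
  rewrite inE mem_cat !negb_or oppr_eq0 a0 (mem_map (@oppr_inj _)) aX andbT.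
  by rewrite -(mem_map (@oppr_inj _)) opprK.
rewrite /sym_free (perm_uniq pX) cons_uniq inE negb_or aNa aN /=.
by apply/andP; split.
Qed.

(** For representatives strictly between 0 and k, being opposite means adding up to exactly k. *)
Lemma sym_free_natr (N : seq nat) : uniq N -> {in N, forall r, 0 < r < k}%N ->
  {in N &, forall r s, r + s <> k}%N -> sym_free [seq (r%:R : 'Z_k) | r <- N].
Proof.
move=> uN rN sN.
have eqk (m : nat) : (0 < m < k + k)%N -> (k %| m)%N -> m = k.
  move=> mk /dvdnP[q mq]; move: mk; rewrite mq => mk.
  have -> : q = 1%N by nia.
  by rewrite mul1n.
have uM : uniq [seq (r%:R : 'Z_k) | r <- N].
  rewrite map_inj_in_uniq // => r s /rN/andP[_ rk] /rN/andP[_ sk].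
  exact: natr_inj_Zp.
rewrite /sym_free cons_uniq cat_uniq uM (map_inj_uniq (@oppr_inj _)) uM andbT /=.
rewrite mem_cat negb_or; apply/andP; split; [apply/andP; split|].
- apply/mapP=> -[r /rN rk] /esym/eqP; rewrite natr_eq0_Zp => /eqk; lia.
- rewrite -oppr0 (mem_map (@oppr_inj _)).
  apply/mapP=> -[r /rN rk] /esym/eqP; rewrite natr_eq0_Zp => /eqk; lia.
- apply/hasPn => _ /mapP[_ /mapP[r rN' ->] ->]; apply/mapP=> -[s sN' e].
  have /eqP : ((r + s)%:R : 'Z_k) = 0 by rewrite natrD -e addrN.
  rewrite natr_eq0_Zp => /eqk rs; apply: (sN r s) => //; apply: rs.
  by have := rN r rN'; have := rN s sN'; lia.
Qed.

Lemma perm_triple_values (R : zmodType) (S : seq (R * R)) :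
  perm_eq (triple_values S)
    (unzip1 S ++ unzip2 S ++ [seq p.1 + p.2 | p <- S]).
Proof.
apply/permP=> c; rewrite !count_cat; elim: S => //= -[a b] S; rewrite /triple_values /= => ->; lia.
Qed.

(* As 3t and 3t + 1 are never both used, two distinct entries of the triples
   sum to at most 6t < k; parity of k excludes r + r = k. *)
Lemma sym_free_triples t : (6 * t < k)%N ->
  exists2 S : seq ('Z_k * 'Z_k), size S = t & sym_free (triple_values S).
Proof.
move=> tk; have [x [[h hrange xP] xI]] := skolem_exists t.
(* The Skolem pair of difference [d], shifted by [t], gives the triple [d], [t + x d],
   [t + x d + d]. The differences fill 1 to [t] and the shifted pairs lie above [t]. *)
pose F d : 'Z_k * 'Z_k := (d%:R, (t + x d)%:R).
exists (map F (iota 1 t)); first by rewrite size_map size_iota.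
pose N := iota 1 t ++ [seq (t + x d)%N | d <- iota 1 t] ++
          [seq (d + (t + x d))%N | d <- iota 1 t].
have pN : perm_eq (triple_values (map F (iota 1 t))) [seq (r%:R : 'Z_k) | r <- N].
  apply: perm_trans (perm_triple_values _) _.
  rewrite /N !map_cat /unzip1 /unzip2 -!map_comp.
  by under [X in perm_eq (_ ++ _ ++ X) _]eq_map => d do rewrite /= -natrD.
rewrite /sym_free.
have pNN := perm_cat pN (perm_map -%R pN).
rewrite cons_uniq (perm_mem pNN) (perm_uniq pNN) -cons_uniq.
have it d : d \in iota 1 t -> (0 < d <= t)%N by rewrite mem_iota; lia.
have xI' d e : (0 < d <= t)%N -> (0 < e <= t)%N -> d <> e ->
     [/\ x d <> x e, x d <> x e + e, x e <> x d + d & x d + d <> x e + e]%N.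
  move=> dt et de; case: (ltnP d e) => lt.
    by apply: xI; lia.
  by have [||? ? ? ?] := xI e d; [lia|lia|]; split; lia.
apply: sym_free_natr.
- rewrite /N !cat_uniq iota_uniq !map_inj_in_uniq ?iota_uniq /=.
  + rewrite !andbT; apply/andP; split; apply/hasPn => r.
    * by rewrite mem_cat => /orP[] /mapP[d /it dt ->]; have [] := xP d dt;
        rewrite mem_iota; lia.
    * move=> /mapP[d /it dt ->]; apply/negP=> /mapP[e /it et].
      case: (eqVneq d e) => [->|/eqP de]; first by lia.
      by have [] := xI' d e dt et de; lia.
  + move=> d e /it dt /it et; case: (eqVneq d e) => // /eqP de.
    by have [] := xI' d e dt et de; lia.
  + move=> d e /it dt /it et; case: (eqVneq d e) => // /eqP de.
    by have [] := xI' d e dt et de; lia.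
- move=> r; rewrite !mem_cat => /or3P[/it dt|/mapP[d /it dt ->]|/mapP[d /it dt ->]];
    [lia|have [] := xP d dt; lia..].
- have rP r : r \in N -> (r <= 3 * t + 1)%N /\ r <> (t + h)%N.
    rewrite !mem_cat => /or3P[/it dt|/mapP[d /it dt ->]|/mapP[d /it dt ->]];
      [lia|have [] := xP d dt; lia..].
  by move=> r s /rP[r1 r2] /rP[s1 s2]; move: k_odd; lia.
Qed.

End SymFreeZp.

(** * Gracefulness *)

Lemma vertex_label_Zp (G : sgraph) (k' : nat) (f : {set G} -> 'Z_k'.+2) (u : G) :
  @vertex_label G k'.+2 f u = (\sum_(v | adj u v) f [set u; v])%R.
Proof.
rewrite /vertex_label -[k'.+2 in LHS]/(Zp_trunc k'.+2).+2 -val_Zp_nat // natr_sum.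
by congr val; apply: eq_bigr => v _; rewrite natr_Zp.
Qed.

Lemma graceful_odd_modulus (G : sgraph) (k : nat) : decomposable [set: G] ->
  odd k -> 1 < k -> #|G| <= k -> modular_edge_graceful G k.
Proof.
move=> [P [T [Pok Tok eG]]] k_odd k_gt1 Gk.
have {}eG : perm_eq (enum G) (pair_elems P ++ triple_elems T).
  by rewrite -(eq_enum (in_setT (T := G)) : enum [set: G] = enum G).
have szP (P0 : seq (G * G)) : size (pair_elems P0) = 2 * size P0.
  by elim: P0 => //= p P0; rewrite /pair_elems /= => ->; lia.
have szT (T0 : seq (G * G * G)) : size (triple_elems T0) = 3 * size T0.
  by elim: T0 => //= p T0; rewrite /triple_elems /= => ->; lia.
case: k k_odd k_gt1 Gk => [|[|k']] // k_odd _ Gk.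
have core (Z : seq G) P0 T0 : size Z <= 1 -> all (@even_pair G) P0 ->
    all (@odd_triple G) T0 ->
    perm_eq (enum G) (Z ++ pair_elems P0 ++ triple_elems T0) -> ~~ odd (size T0) ->
    modular_edge_graceful G k'.+2.
  move=> Z1 P0ok T0ok eG0 evT; pose t := (size T0)./2.
  have sT : size T0 = 2 * t by rewrite /t; lia.
  have cG : #|G| = size Z + 2 * size P0 + 6 * t.
    rewrite cardE (perm_size eG0) !size_cat szP szT sT -addnA.
    by congr (_ + _); lia.
  (* Equality is excluded because k is odd. *)
  have tk : 6 * t < k'.+2 by lia.
  have [S sS frS] := sym_free_triples k_odd tk.
  have szS : size (triple_values S) = 3 * t.
    by rewrite -sS; elim: (S) => //= p S0; rewrite /triple_values /= => ->; lia.
  (* The room left is [size Z + 2 * size P0 + 6 * t <= k]; for empty [Z], strictness again comes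
     from the parity of k. *)
  have [|Q sQ frQ] := @sym_free_extend _ k_odd _ (size P0) frS; first by rewrite szS; lia.
  have [||||||f f_inj] := @injective_labeling G _ Z P0 (take t T0) (drop t T0) Q S Z1 P0ok;
    rewrite ?cat_take_drop // ?size_drop ?size_takel ?sS //; try (rewrite /t; lia).
  exists f => u v; rewrite !vertex_label_Zp => /val_inj; exact: f_inj.
case oT: (odd (size T)); last first.
  by apply: (core [::] P T) => //; rewrite oT.
(* An odd number of triples: the centre [u] of the first becomes the single vertex labelled 0, and
   its ends [v], [z] form an even pair. *)
case: T oT Tok eG => //= -[[u v] z] T oT /andP[/andP[/= uv uz] Tok] eG.
apply: (core [:: u] ((v, z) :: P) T) => //.
  by rewrite /= Pok andbT; exact: (walk_trans (walk_sym uv) uz).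
apply: perm_trans eG _; apply/permP=> c.
by rewrite /pair_elems /triple_elems /= !count_cat /=; lia.
Qed.

(** * The parity obstruction and the value of k(G) *)

Lemma even_symmetric_sum (T : finType) (e : rel T) (F : T -> T -> nat) :
  symmetric e -> irreflexive e -> (forall u v, F u v = F v u) ->
  ~~ odd (\sum_u \sum_(v | e u v) F u v).
Proof.
move=> esym eirr Fsym.
(* Each edge is counted once from either end; comparing ranks selects one of its two
   orientations. *)
pose lo := \sum_u \sum_(v | e u v && (enum_rank u < enum_rank v)) F u v.
suff -> : \sum_u \sum_(v | e u v) F u v = lo + lo by rewrite addnn odd_double.
rewrite {2}/lo.
have -> : \sum_u \sum_(v | e u v && (enum_rank u < enum_rank v)) F u v =
          \sum_u \sum_(v | e u v && ~~ (enum_rank u < enum_rank v)) F u v.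
  rewrite (exchange_big_dep predT) //=; apply: eq_bigr => u _.
  apply: eq_big => v; last by rewrite Fsym.
  rewrite esym -leqNgt [in RHS]leq_eqVlt; case: eqP => [|_] //.
  by move/ord_inj/enum_rank_inj => <-; rewrite eirr.
rewrite /lo -big_split; apply: eq_bigr => u _.
by rewrite (bigID (fun v => enum_rank u < enum_rank v)).
Qed.

Lemma not_graceful_2mod4 (G : sgraph) : #|G| = 2 %[mod 4] ->
  ~ modular_edge_graceful G #|G|.
Proof.
move=> G2 [f f_inj]; have G0 : 0 < #|G| by lia.
pose s u := \sum_(v | adj u v) f [set u; v].
pose h u : 'I_#|G| := Ordinal (ltn_pmod (s u) G0).
have h_bij : bijective h.
  by apply: inj_card_bij; rewrite ?card_ord // => u v [/f_inj].
have : \sum_u s u %% #|G| = 'C(#|G|, 2).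
  rewrite -bin2_sum big_mkord (reindex h) //.
  exact: onW_bij.
(* As the modulus is even here, reduction preserves the parity of the sum. *)
have : \sum_u s u = (\sum_u s u %/ #|G|) * #|G| + \sum_u s u %% #|G|.
  by rewrite big_distrl -big_split; apply: eq_bigr => u _; apply: divn_eq.
have : ~~ odd (\sum_u s u).
  apply: even_symmetric_sum; [exact: adj_sym|exact: adj_irrefl|].
  by move=> u v; rewrite setUC.
rewrite bin2 => evS eqS eqC; move: evS; rewrite eqS eqC.
have [q ->] : exists q, #|G| = 4 * q + 2 by exists (#|G| %/ 4); lia.
have -> : ((4 * q + 2) * (4 * q + 2).-1)./2 = 4 * q * (2 * q) + 6 * q + 1 by nia.
by rewrite !(oddD, oddM) /= andbF.
Qed.

(** For n = 0 mod 4 both n and n + 1 remain possible, so the proof must decide whether n is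
    admissible; only finitely many labelings exist. *)
Lemma graceful_dec (G : sgraph) (k : nat) : decidable (modular_edge_graceful G k).
Proof.
apply: (@decP _ [exists f : {ffun {set G} -> 'I_k}, injectiveb (vertex_label f)]).
apply: (iffP existsP) => [[f /injectiveP f_inj]|[f f_inj]]; first by exists f.
exists (finfun f); apply/injectiveP => u v e; apply: f_inj.
have vlE y : vertex_label (finfun f) y = vertex_label f y.
  by congr (_ %% _); apply: eq_bigr => z _; rewrite ffunE.
by rewrite -!vlE.
Qed.

Theorem theorem1p6 (G : sgraph) (n : nat) (order_G : #|G| = n)
  (no_small : forall C, C \in components G -> ~ (#|C| < 3))
  (no_odd_star : forall C, C \in components G ->
     forall u : nat, 1 <= u -> ~ graph_iso (induced C) (biclique 1 (2 * u + 1))) :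
  exists2 k : nat, is_gracefulness G k &
    [/\ n = 1 %[mod 2] -> k = n,
        n = 2 %[mod 4] -> k = n + 1
      & n = 0 %[mod 4] -> k <= n + 1].
Proof.
have compG x : component x \in components G by apply: imset_f.
have C2 (x : G) : 2 < #|component x| by rewrite ltnNge; apply/negP => /(no_small _ (compG x)).
have decG : decomposable [set: G].
  apply: decomposable_closed => [x _|//|x [u u1]]; first exact: subsetT.
  exact: (no_odd_star _ (compG x)).
have grK k : odd k -> n <= k -> modular_edge_graceful G k.
  move=> k_odd nk; have [k1|k_gt1] := leqP k 1; last first.
    by apply: graceful_odd_modulus; rewrite ?order_G.
  (* Modulus 1 is kept apart from ['Z_k]. Any vertex would lie in a component of at least 3
     vertices, so the graph is empty and injectivity is vacuous. *)
  have Ek : k = 1 by lia.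
  rewrite Ek; exists (fun=> ord0) => x.
  by have := C2 x; have := max_card (component x); lia.
have [grn|Ngrn] := graceful_dec G n.
  exists n; first by split; rewrite ?order_G.
  split=> // [n2|_]; last by rewrite leq_addr.
  by case: (@not_graceful_2mod4 G); rewrite order_G.
(* If n fails, it is even, and n + 1 is an odd modulus. *)
have n_even : ~~ odd n by apply/negP => n_odd; apply: Ngrn; apply: grK.
exists (n + 1); last by split=> //; lia.
split; [by rewrite order_G leq_addr|by apply: grK; lia|].
move=> j; rewrite order_G leq_eqVlt addn1 => /orP[/eqP <- //|//].
Qed.
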